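(* Let $\alpha: A\to B$ be a homomorphism of graded commutative dg $R$-algebras. (a) The complex $M=\operatorname{Cone}(\alpha_{\ge 1})[1]$ is a dg $A$-module with multiplication defined, for homogeneous $a\in A$ and $m \in M$, by $$am=\begin{cases}((-1)^{|a|}\alpha(a)b,\;ac), & m=(b,c)\in M \text{ homogeneous of degree}\ge 1,\\ ((-1)^{|a|}\alpha(a)m,\;-a\,\partial^B(m)), & m\in M_0=B_1,\ |a|\ge 1.\end{cases}$$ (b) There is a homomorphism of dg $A$-modules $\beta:M\to A$ given by $$\beta(m)=\begin{cases}-c, & m=(b,c) \text{ homogeneous of degree}\ge 1,\\ \partial^B(m), & m\in M_0=B_1.\end{cases}$$ (c) There is an $A$-linear nullhomotopy $\mu:M\otimes M\to M$ for the induced homomorphism $\theta:M\otimes M\to M$ defined by $\theta(m\otimes n)=m\beta(n)-\beta(m)n$, where $$\mu(m\otimes n)=\begin{cases}(-(-1)^{|b|}bd,\,0), & m=(b,c),\ n=(d,e) \text{ homogeneous of degree}\ge1,\\ (md,\,0), & m\in M_0,\ n=(d,e)\text{ homogeneous of degree}\ge1,\\ (-(-1)^{|b|}bn,\,0), & n\in M_0,\ m=(b,c)\text{ homogeneous of degree}\ge1,\\ (mn,\,0), & m,n\in M_0=B_1,\end{cases}$$ and $\mu$ satisfies $\beta\mu=0$, as well as $$\mu(\mu(m\otimes n)\otimes u)=-(-1)^{|m|}\mu(m\otimes\mu(n\otimes u))\quad\text{and}\quad \mu(m\otimes n)=-(-1)^{|m||n|}\mu(n\otimes m)$$ for all homogeneous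 $m,n,u\in M$. Moreover, if $B$ is strictly commutative, then $\mu(m\otimes m)=0$ for all homogeneous $m\in M$ with $|m|$ even.
   Context: $R$ is a commutative ring. A graded $R$-algebra is a $\mathbb{Z}$-graded (associative, unital) ring $A$ with $A_i=0$ for $i<0$ and $A_0=R$. It is graded commutative if $ab=(-1)^{|a||b|}ba$ for all homogeneous $a,b$, and strictly commutative if moreover $a^2=0$ for all homogeneous $a$ of odd degree. A dg $R$-algebra is a graded $R$-algebra with a differential $\partial$ (degree $-1$, $\partial^2=0$) satisfying $\partial(ab)=\partial(a)b+(-1)^{|a|}a\partial(b)$. A homomorphism of dg $R$-algebras is a graded $R$-algebra homomorphism (so the identity on $R$ in degree $0$) that is a chain map. A (left) dg $A$-module is a graded left $A$-module $M$ with a differential of degree $-1$ with $\partial^M(am)=\partial^A(a)m+(-1)^{|a|}a\partial^M(m)$. When $A$ is graded commutative, $M$ is also a right dg $A$-module via $ma=(-1)^{|a||m|}am$. A graded $R$-linear map $f$ of degree $s$ is $A$-linear if $f(am)=(-1)^{|a|s}af(m)$ (equivalently $f(ma)=f(m)a$). A homomorphism of dg modules is an $A$-linear chain map of degree $0$. $M\otimes N$ is the tensor product over $A$: the quotient of $M\otimes_RN$ by the elements $ma\otimes n-m\otimes an$, with differential $\partial(m\otimes n)=\partial m\otimes n+(-1)^{|m|}m\otimes\partial n$ and $(m\otimes n)a=m\otimes na$. An $A$-linear nullhomotopy for $\theta$ is an $A$-linear map $\mu$ of degree $1$ with $\partial^M\mu+\mu\partial^{M\otimes M}=\theta$. $\alpha_{\ge1}:A_{\ge1}\to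 B_{\ge1}$ is the restriction of $\alpha$ to the truncated complexes of elements of positive degree (the differential out of degree $1$ being $0$). The complex $M=\operatorname{Cone}(\alpha_{\ge1})[1]$ is, explicitly: $M_0=B_1$, $M_i=B_{i+1}\oplus A_i$ for $i\ge1$, and $M_i=0$ for $i<0$, with $\partial^M(b,c)=(-\partial^B(b)-\alpha(c),\partial^A(c))$ for $(b,c)\in M_i$, $i\ge2$, and $\partial^M(b,c)=-\partial^B(b)-\alpha(c)\in M_0$ for $(b,c)\in M_1$. In the formulas, $|b|$ and $|d|$ denote degrees in $B$, and $|c|$ and $|e|$ degrees in $A$. The action of $A_0=R$ on $M$ is the natural $R$-module structure. *)

(* Defs.v *)
From HB Require Import structures.
From mathcomp Require Import all_boot all_order all_algebra.
From mathcomp Require Import boolp.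
From mathcomp.multinomials Require Import freeg.

Set Implicit Arguments.
Unset Strict Implicit.
Unset Printing Implicit Defensive.

Import GRing.Theory.
Local Open Scope ring_scope.
Local Open Scope quotient_scope.

(* The Koszul sign (-1)^i, used through the action x *~ n of int on Z-modules.*)
Definition sgn (i : int) : int := (-1) ^+ absz i.

Lemma oddzD (i j : int) : odd (absz (i + j)) = odd (absz i) (+) odd (absz j).
Proof.
have h n m : (m <= n)%N -> odd (absz (n%:Z - m%:Z)) = odd n (+) odd m.
  by move=> mn; rewrite subzn // absz_nat oddB.
have hN n m : odd (absz (n%:Z - m%:Z)) = odd n (+) odd m.
  case: (leqP m n) => [/h//|/ltnW /h]; by rewrite -opprB abszN addbC.
case: i j => [i|i] [j|j]; rewrite ?NegzE ?abszN ?absz_nat.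
- by rewrite -oddD -[RHS]/(odd (absz (i + j)%N%:Z)) PoszD.
- exact: hN.
- by rewrite addrC hN addbC.
- by rewrite -opprD abszN -oddD -[RHS]/(odd (absz (i.+1 + j.+1)%N%:Z)) PoszD.
Qed.

Lemma oddzM (i j : int) : odd (absz (i * j)) = odd (absz i) && odd (absz j).
Proof. by rewrite abszM oddM. Qed.

Lemma oddzN (i : int) : odd (absz (- i)) = odd (absz i).
Proof. by rewrite abszN. Qed.

Lemma sgnE i : sgn i = (-1) ^+ odd (absz i).
Proof. by rewrite /sgn signr_odd. Qed.

Definition sgn_simp := (sgnE, oddzD, oddzM, oddzN).

(* A chain complex structure on V.  The grading V = (+)_i V_i is encoded by  *)
(* its projections comp i : V -> V_i, seen as endomorphisms of V.            *)
Record complex_on (V : zmodType) := ComplexOn {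
  comp : int -> {additive V -> V};
  diff : {additive V -> V};
  comp_comp : forall i j x, comp i (comp j x) = if i == j then comp j x else 0;
  comp_sum : forall x, exists s : seq int, uniq s /\ x = \sum_(i <- s) comp i x;
  diff_deg : forall i x, comp i x = x -> comp (i - 1) (diff x) = diff x;
  diffK : forall x, diff (diff x) = 0
}.

Definition homog (V : zmodType) (C : complex_on V) (i : int) (x : V) : Prop :=
  comp C i x = x.

Section GradingTheory.
Variables (V : zmodType) (C : complex_on V).
Implicit Types (x y : V) (i j : int).

Lemma homog_comp i x : homog C i (comp C i x).
Proof. by rewrite /homog comp_comp eqxx. Qed.

Lemma homog0 i : homog C i 0.
Proof. exact: raddf0. Qed.

Lemma homogD i x y : homog C i x -> homog C i y -> homog C i (x + y).
Proof. by rewrite /homog raddfD => -> ->. Qed.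

Lemma homogMz i x n : homog C i x -> homog C i (x *~ n).
Proof. by rewrite /homog raddfMz => ->. Qed.

Lemma comp_homog i j x : homog C j x -> comp C i x = if i == j then x else 0.
Proof. by move=> <-; rewrite comp_comp. Qed.

Lemma homog_ind (P : V -> Prop) :
  P 0 -> (forall x y, P x -> P y -> P (x + y)) ->
  (forall i x, homog C i x -> P x) -> forall x, P x.
Proof.
move=> P0 PD Ph x; have [s [_ ->]] := comp_sum C x.
by elim/big_ind: _ => // i _; apply: Ph (homog_comp i x).
Qed.

Lemma homog_ext (W : zmodType) (f g : V -> W) :
  {morph f : x y / x + y} -> {morph g : x y / x + y} -> f 0 = 0 -> g 0 = 0 ->
  (forall i x, homog C i x -> f x = g x) -> f =1 g.
Proof.
move=> fD gD f0 g0 fg; apply: homog_ind; first by rewrite f0.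
  by move=> x y fx fy; rewrite fD gD fx fy.
exact: fg.
Qed.

Lemma diff_comp i x : comp C (i - 1) (diff C x) = diff C (comp C i x).
Proof.
move: x; apply: homog_ext => [x y|x y|||j x hx]; rewrite ?raddfD ?raddf0 //.
rewrite (comp_homog i hx) (comp_homog (i - 1) (diff_deg hx)).
by rewrite (inj_eq (addIr _)); case: eqP => // _; rewrite raddf0.
Qed.

Definition supp x : seq int := projT1 (cid (comp_sum C x)).

Lemma supp_uniq x : uniq (supp x).
Proof. by rewrite /supp; case: cid => s []. Qed.

Lemma supp_sum x : x = \sum_(i <- supp x) comp C i x.
Proof. by rewrite /supp; case: cid => s []. Qed.

Lemma supp_out i x : i \notin supp x -> comp C i x = 0.
Proof.
move=> ix; rewrite [in LHS](supp_sum x) raddf_sum big_seq big1 // => j jx.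
by rewrite comp_comp; case: eqP => // ij; rewrite -ij (negPf ix) in jx.
Qed.

(* The extension of a family of maps F i, defined on V_i, to a map on V. *)
Definition hsum (W : zmodType) (F : int -> V -> W) (x : V) : W :=
  \sum_(i <- supp x) F i (comp C i x).

Section Hsum.
Variables (W : zmodType) (F : int -> V -> W).
Hypothesis F0 : forall i, F i 0 = 0.

Lemma hsumE x s : uniq s -> (forall i, i \notin s -> comp C i x = 0) ->
  hsum F x = \sum_(i <- s) F i (comp C i x).
Proof.
move=> us sx; rewrite /hsum.
rewrite (bigID (mem s)) /= [X in _ + X]big1 ?addr0; last first.
  by move=> i /sx ->; rewrite F0.
rewrite [RHS](bigID (mem (supp x))) /= [X in _ + X]big1 ?addr0; last first.
  by move=> i /supp_out ->; rewrite F0.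
rewrite -[LHS]big_filter -[RHS]big_filter; apply: perm_big; apply: uniq_perm.
- exact/filter_uniq/supp_uniq.
- exact: filter_uniq.
by move=> i; rewrite !mem_filter andbC.
Qed.

Lemma hsum_homog i x : homog C i x -> hsum F x = F i x.
Proof.
move=> hx; rewrite (@hsumE x [:: i]) ?big_seq1 ?hx // => j.
by rewrite inE (comp_homog _ hx) => /negPf ->.
Qed.

Lemma hsum0 : hsum F 0 = 0.
Proof. by rewrite (hsum_homog (homog0 0)). Qed.

Hypothesis FD : forall i, {morph F i : x y / x + y}.

Lemma hsumD : {morph hsum F : x y / x + y}.
Proof.
move=> x y; pose s := undup (supp x ++ supp y).
have sP i : i \notin s -> (comp C i x = 0) * (comp C i y = 0).
  by rewrite mem_undup mem_cat negb_or => /andP[/supp_out -> /supp_out ->].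
have us : uniq s by exact: undup_uniq.
have hx i : i \notin s -> comp C i x = 0 by case/sP.
have hy i : i \notin s -> comp C i y = 0 by case/sP.
have hxy i : i \notin s -> comp C i (x + y) = 0.
  by case/sP=> h1 h2; rewrite raddfD /= h1 h2 addr0.
rewrite (hsumE us hx) (hsumE us hy) (hsumE us hxy) -big_split /=.
by apply: eq_bigr => i _; rewrite raddfD FD.
Qed.

End Hsum.

End GradingTheory.

(* Graded algebras in non-negative degrees with A_0 = R: dga_unit is the     *)
(* inclusion R = A_0 -> A and dga_base the projection A -> A_0 = R.          *)
Record dgAlgebra (R : comPzRingType) := DGAlgebra {
  dga_ring :> pzRingType;
  dga_complex :> complex_on dga_ring;
  dga_unit : {rmorphism R -> dga_ring};
  dga_base : dga_ring -> R;
  dga_ge0 : forall i a, i < 0 -> homog dga_complex i a -> a = 0;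
  dga_unitK : forall r, dga_base (dga_unit r) = r;
  dga_baseK : forall a, dga_unit (dga_base a) = comp dga_complex 0 a;
  dga_mul_deg : forall i j a b,
    homog dga_complex i a -> homog dga_complex j b ->
    homog dga_complex (i + j) (a * b);
  dga_leibniz : forall i a b, homog dga_complex i a ->
    diff dga_complex (a * b) =
    diff dga_complex a * b + (a * diff dga_complex b) *~ sgn i
}.

Definition graded_commutative R (A : dgAlgebra R) : Prop :=
  forall i j (a b : A), homog A i a -> homog A j b ->
    a * b = (b * a) *~ sgn (i * j).

Definition strictly_commutative R (A : dgAlgebra R) : Prop :=
  graded_commutative A /\
  forall i (a : A), odd (absz i) -> homog A i a -> a * a = 0.

Record dgHom R (A B : dgAlgebra R) := DGHom {
  dgh_fun :> {rmorphism A -> B};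
  dgh_unit : forall r, dgh_fun (dga_unit A r) = dga_unit B r;
  dgh_deg : forall i a, homog A i a -> homog B i (dgh_fun a);
  dgh_diff : forall a, dgh_fun (diff A a) = diff B (dgh_fun a)
}.

(* Left A-module structures on a fixed abelian group V. *)
Record scalar_action (A : pzRingType) (V : zmodType) := ScalarAction {
  smul : A -> V -> V;
  smulA : forall a b v, smul a (smul b v) = smul (a * b) v;
  smul1 : forall v, smul 1 v = v;
  smulDr : forall a, {morph smul a : u v / u + v};
  smulDl : forall v, {morph smul^~ v : a b / a + b}
}.

Section ScalarActionModule.
Variables (A : pzRingType) (V : zmodType) (s : scalar_action A V).

(* V itself; s is recorded in the type so that it can be inferred from it. *)
Definition acted : Type := let _ := s in V.

HB.instance Definition _ := GRing.Zmodule.copy acted V.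
HB.instance Definition _ := GRing.Zmodule_isLmodule.Build A acted
  (smulA s) (smul1 s) (smulDr s) (smulDl s).

Definition lmod_of : lmodType A := acted.

End ScalarActionModule.

Definition is_dgmodule R (A : dgAlgebra R) (M : lmodType A)
    (C : complex_on M) : Prop :=
  (forall i j (a : A) (m : M),
     homog A i a -> homog C j m -> homog C (i + j) (a *: m)) /\
  (forall i (a : A) (m : M), homog A i a ->
     diff C (a *: m) = diff A a *: m + (a *: diff C m) *~ sgn i).

Record dgModule R (A : dgAlgebra R) := DGModule {
  dgm_lmod :> lmodType A;
  dgm_complex :> complex_on dgm_lmod;
  dgm_axioms : is_dgmodule dgm_complex
}.

Definition regular R (A : dgAlgebra R) : dgModule A :=
  @DGModule R A (A : pzRingType)^o A
    (conj (@dga_mul_deg R A) (@dga_leibniz R A)).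

(* The right action m a = (-1)^(|a||m|) a m, extended from homogeneous m, a. *)
Definition ract R (A : dgAlgebra R) (M : dgModule A) (m : M) (a : A) : M :=
  hsum M (fun i m_i => hsum A (fun j a_j => (a_j *: m_i) *~ sgn (i * j)) a) m.

Definition Alinear R (A : dgAlgebra R) (M N : dgModule A) (s : int)
    (f : M -> N) : Prop :=
  (forall i m, homog M i m -> homog N (i + s) (f m)) /\
  (forall i (a : A) m, homog A i a -> f (a *: m) = (a *: f m) *~ sgn (i * s)).

Record dgModHom R (A : dgAlgebra R) (M N : dgModule A) := DGModHom {
  dgmh_fun :> {additive M -> N};
  dgmh_linear : Alinear 0 dgmh_fun;
  dgmh_diff : forall m, dgmh_fun (diff M m) = diff N (dgmh_fun m)
}.

Section DGModuleTheory.
Variables (R : comPzRingType) (A : dgAlgebra R) (M : dgModule A).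
Implicit Types (a : A) (m : M).

Lemma dgm_deg i j a m :
  homog A i a -> homog M j m -> homog M (i + j) (a *: m).
Proof. by case: (dgm_axioms M) => h _; apply: h. Qed.

Lemma dgm_leibniz i a m : homog A i a ->
  diff M (a *: m) = diff A a *: m + (a *: diff M m) *~ sgn i.
Proof. by case: (dgm_axioms M) => _; apply. Qed.

Lemma ract_homog i j m a : homog M i m -> homog A j a ->
  ract m a = (a *: m) *~ sgn (i * j).
Proof.
move=> hm ha; rewrite /ract (hsum_homog _ hm); last first.
  by move=> k; rewrite /hsum big1 // => l _; rewrite scaler0 mul0rz.
by rewrite (hsum_homog _ ha) // => k; rewrite scale0r mul0rz.
Qed.

Lemma ractDl a : {morph (fun m => ract m a) : m n / m + n}.
Proof.
apply: hsumD => i; first by rewrite /hsum big1 // => j _; rewrite scaler0 mul0rz.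
move=> m n; rewrite /hsum -big_split /=; apply: eq_bigr => j _.
by rewrite scalerDr mulrzDl.
Qed.

Lemma ractDr m : {morph (fun a => ract m a) : a b / a + b}.
Proof.
move=> a b; rewrite /ract {1 3 5}/hsum -big_split /=; apply: eq_bigr => i _.
apply: hsumD => [j|j {}a {}b]; first by rewrite scale0r mul0rz.
by rewrite scalerDl mulrzDl.
Qed.

Lemma ract0l a : ract (0 : M) a = 0.
Proof.
by apply: hsum0 => i; rewrite /hsum big1 // => j _; rewrite scaler0 mul0rz.
Qed.

Lemma ract0r m : ract m 0 = 0.
Proof. by apply: (addrI (ract m 0)); rewrite -ractDr !addr0. Qed.

End DGModuleTheory.

Section Tensor.
Variables (R : comPzRingType) (A : dgAlgebra R) (M N : dgModule A).
Implicit Types (a : A) (m : M) (n : N).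

Let F := {freeg (M * N)%type}.

(* M (x)_A N is the free abelian group on M * N modulo biadditivity and      *)
(* (m a) (x) n = m (x) (a n).  As A_0 = R, the case a in A_0 of the latter is*)
(* the R-balancedness defining M (x)_R N.                                    *)
Inductive tensor_rel : F -> Prop :=
| tensor_relDl m m' n :
    tensor_rel (<< (m + m', n) >> - << (m, n) >> - << (m', n) >>)
| tensor_relDr m n n' :
    tensor_rel (<< (m, n + n') >> - << (m, n) >> - << (m, n') >>)
| tensor_relA m a n : tensor_rel (<< (ract m a, n) >> - << (m, a *: n) >>)
| tensor_rel0 : tensor_rel 0
| tensor_relB x y : tensor_rel x -> tensor_rel y -> tensor_rel (x - y).

Definition tensor_ker : {pred F} := fun x => `[< tensor_rel x >].

Lemma tensor_ker_zmod : zmod_closed tensor_ker.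
Proof.
split=> [|x y /asboolP hx /asboolP hy]; apply/asboolP.
  exact: tensor_rel0.
exact: tensor_relB.
Qed.

HB.instance Definition _ := GRing.isZmodClosed.Build F tensor_ker tensor_ker_zmod.

Definition tensor_type : zmodType := Quotient.quot tensor_ker.

Definition tens m n : tensor_type :=
  \pi_(Quotient.quot tensor_ker) << (m, n) >>.

Lemma tens_eq (x y : F) : tensor_rel (x - y) ->
  \pi_(Quotient.quot tensor_ker) x = \pi_(Quotient.quot tensor_ker) y.
Proof. by move=> h; apply/eqP; rewrite -Quotient.idealrBE; apply/asboolP. Qed.

Lemma tensDl m m' n : tens (m + m') n = tens m n + tens m' n.
Proof.
rewrite -[RHS]raddfD; apply: tens_eq; rewrite opprD addrA; exact: tensor_relDl.
Qed.

Lemma tensDr m n n' : tens m (n + n') = tens m n + tens m n'.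
Proof.
rewrite -[RHS]raddfD; apply: tens_eq; rewrite opprD addrA; exact: tensor_relDr.
Qed.

Lemma tens_ract m a n : tens (ract m a) n = tens m (a *: n).
Proof. by apply: tens_eq; exact: tensor_relA. Qed.

Lemma tens0l n : tens 0 n = 0.
Proof. by apply: (addrI (tens 0 n)); rewrite -tensDl !addr0. Qed.

Lemma tens0r m : tens m 0 = 0.
Proof. by apply: (addrI (tens m 0)); rewrite -tensDr !addr0. Qed.

Lemma tensMzl m n z : tens (m *~ z) n = tens m n *~ z.
Proof.
pose f m' := tens m' n.
have fB : zmod_morphism f.
  by move=> x y; apply: (addIr (f y)); rewrite subrK /f -tensDl subrK.
pose f' : {additive M -> tensor_type} := HB.pack f (GRing.isZmodMorphism.Build _ _ f fB).
exact: (raddfMz f').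
Qed.

Lemma tensMzr m n z : tens m (n *~ z) = tens m n *~ z.
Proof.
pose f n' := tens m n'.
have fB : zmod_morphism f.
  by move=> x y; apply: (addIr (f y)); rewrite subrK /f -tensDr subrK.
pose f' : {additive N -> tensor_type} := HB.pack f (GRing.isZmodMorphism.Build _ _ f fB).
exact: (raddfMz f').
Qed.

Lemma tensor_ind (P : tensor_type -> Prop) :
  P 0 -> (forall x y, P x -> P y -> P (x + y)) ->
  (forall i j m n, homog M i m -> homog N j n -> P (tens m n)) ->
  forall t, P t.
Proof.
move=> P0 PD Pt.
have Pt1 m n : P (tens m n).
  move: m; apply: (@homog_ind _ M) => [|x y|i m hm]; rewrite ?tens0l ?tensDl //.
    exact: PD.
  move: n; apply: (@homog_ind _ N) => [|x y|j n hn]; rewrite ?tens0r ?tensDr //.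
    exact: PD.
  exact: Pt hm hn.
have PMn m n k : P (tens m n *+ k).
  by elim: k => [|k ih]; rewrite ?mulr0n // mulrS; apply: PD.
elim/quotW=> x; rewrite -(freeg_sumE x) raddf_sum.
elim/big_ind: _ => // -[m n] _.
have -> : << coeff (m, n) x *g (m, n) >> = << (m, n) >> *~ coeff (m, n) x :> F.
  by rewrite freeg_mulz intz.
rewrite raddfMz -/(tens m n); case: (coeff _ _) => k; first exact: PMn.
have tN : - tens m n = tens (- m) n by rewrite -mulrN1z -tensMzl mulrN1z.
by rewrite NegzE mulrNz -mulNrz tN; exact: PMn.
Qed.

Section Lift.
Variables (V : zmodType) (f : M -> N -> V).

Definition tensor_lift (t : tensor_type) : V :=
  fglift (fun p => f p.1 p.2 : zmodule V) (repr t : F).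

Hypotheses (fDl : forall n, {morph f^~ n : x y / x + y})
           (fDr : forall m, {morph f m : x y / x + y})
           (fA : forall m a n, f (ract m a) n = f m (a *: n)).

Let g : F -> V := fglift (fun p => f p.1 p.2 : zmodule V).

Lemma tensor_lift_gB : zmod_morphism g.
Proof. exact: (@lift_is_additive _ _ (zmodule V)). Qed.

Lemma tensor_lift_gU p : g << p >> = f p.1 p.2.
Proof. by rewrite /g liftU scale1r. Qed.

Lemma tensor_lift_rel x : tensor_rel x -> g x = 0.
Proof.
elim=> [m m' n|m n n'|m a n||{}x y _ hx _ hy];
  rewrite ?tensor_lift_gB ?tensor_lift_gU /=.
- by rewrite fDl addrAC addrK subrr.
- by rewrite fDr addrAC addrK subrr.
- by rewrite fA subrr.
- by rewrite -[X in g X](subrr 0) tensor_lift_gB subrr.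
- by rewrite hx hy subrr.
Qed.

Lemma tensor_lift_pi x : tensor_lift (\pi_(Quotient.quot tensor_ker) x) = g x.
Proof.
rewrite /tensor_lift -/g; apply/eqP; rewrite -subr_eq0 -tensor_lift_gB.
apply/eqP/tensor_lift_rel/asboolP.
by have /eqP := reprK (\pi_(Quotient.quot tensor_ker) x); rewrite -Quotient.idealrBE.
Qed.

Lemma tensor_liftE m n : tensor_lift (tens m n) = f m n.
Proof. by rewrite tensor_lift_pi tensor_lift_gU. Qed.

Lemma tensor_liftB : zmod_morphism tensor_lift.
Proof.
elim/quotW=> x; elim/quotW=> y.
by rewrite -raddfB !tensor_lift_pi tensor_lift_gB.
Qed.

Definition tensor_map : {additive tensor_type -> V} :=
  HB.pack tensor_lift (GRing.isZmodMorphism.Build _ _ tensor_lift tensor_liftB).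

End Lift.

End Tensor.

Section TensorDGModule.
Variables (R : comPzRingType) (A : dgAlgebra R).
Hypothesis gcA : graded_commutative A.
Variables (M N : dgModule A).
Implicit Types (a : A) (m : M) (n : N).

Local Notation T := (tensor_type M N).

Lemma tensor_balanced (V : zmodType) (f : M -> N -> V) :
  (forall n, {morph f^~ n : x y / x + y}) ->
  (forall m, {morph f m : x y / x + y}) ->
  (forall i j k m a n, homog M i m -> homog A j a -> homog N k n ->
     f ((a *: m) *~ sgn (i * j)) n = f m (a *: n)) ->
  forall m a n, f (ract m a) n = f m (a *: n).
Proof.
move=> fDl fDr fA m a n.
have f0l x : f 0 x = 0 by apply: (addrI (f 0 x)); rewrite -fDl !addr0.
have f0r x : f x 0 = 0 by apply: (addrI (f x 0)); rewrite -fDr !addr0.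
move: m; apply: (@homog_ext _ M) => [x y|x y|||i m hm];
  rewrite ?ract0l ?f0l ?ractDl ?fDl //.
move: a; apply: (@homog_ext _ A) => [x y|x y|||j a ha];
  rewrite ?ract0r ?scale0r ?f0l ?f0r ?ractDr ?scalerDl ?fDl ?fDr //.
move: n; apply: (@homog_ext _ N) => [x y|x y|||k n hn];
  rewrite ?scaler0 ?f0r ?scalerDr ?fDr //.
by rewrite (ract_homog hm ha) (fA _ _ _ _ _ _ hm ha hn).
Qed.

Lemma tens_ract_homog i j m a n : homog M i m -> homog A j a ->
  tens m (a *: n) = tens (a *: m) n *~ sgn (i * j).
Proof. by move=> hm ha; rewrite -tens_ract (ract_homog hm ha) tensMzl. Qed.

(* M (x) N in degree k is spanned by the m (x) n with |m| + |n| = k. *)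
Definition tcomp (k : int) (m : M) (n : N) : T :=
  hsum M (fun i m_i => tens m_i (comp N (k - i) n)) m.

Lemma tcomp_homogl k i m (n : N) :
  homog M i m -> tcomp k m n = tens m (comp N (k - i) n).
Proof. by move=> hm; rewrite /tcomp (hsum_homog _ hm) // => j; rewrite tens0l. Qed.

Lemma tcompDl k n : {morph (tcomp k)^~ n : x y / x + y}.
Proof. by apply: hsumD => [i|i x y]; rewrite ?tens0l ?tensDl. Qed.

Lemma tcompDr k m : {morph tcomp k m : x y / x + y}.
Proof.
move=> x y; rewrite /tcomp /hsum -big_split /=; apply: eq_bigr => i _.
by rewrite raddfD tensDr.
Qed.

Lemma tcompA k m a n : tcomp k (ract m a) n = tcomp k m (a *: n).
Proof.
move: m a n; apply: tensor_balanced; [exact: tcompDl|exact: tcompDr|].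
move=> i j l m a n hm ha hn.
rewrite (tcomp_homogl k (a *: n) hm).
rewrite (tcomp_homogl k n (homogMz _ (dgm_deg ha hm))).
rewrite (comp_homog _ hn) (comp_homog _ (dgm_deg ha hn)).
rewrite -[k - i == _](inj_eq (addrI (- j))) addKr.
have -> : - j + (k - i) = k - (j + i) by rewrite opprD addrCA addrA.
by case: eqP => _; rewrite ?tens0r // tensMzl (tens_ract_homog n hm ha).
Qed.

Definition tensor_comp (k : int) : {additive T -> T} :=
  tensor_map (tcompDl k) (tcompDr k) (tcompA k).

Lemma tensor_compE k i j m n : homog M i m -> homog N j n ->
  tensor_comp k (tens m n) = if k == i + j then tens m n else 0.
Proof.
move=> hm hn; rewrite [LHS](tensor_liftE (tcompDl k) (tcompDr k) (tcompA k)).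
rewrite (tcomp_homogl _ _ hm) (comp_homog _ hn) subr_eq addrC.
by case: eqP; rewrite ?tens0r // addrC.
Qed.

Definition twist m : M := hsum M (fun i m_i => m_i *~ sgn i) m.

Lemma twist_homog i m : homog M i m -> twist m = m *~ sgn i.
Proof. by move=> hm; rewrite /twist (hsum_homog _ hm) // => j; rewrite mul0rz. Qed.

Lemma twistD : {morph twist : x y / x + y}.
Proof. by apply: hsumD => [i|i x y]; rewrite ?mul0rz ?mulrzDl. Qed.

Definition tdiff (m : M) (n : N) : T :=
  tens (diff M m) n + tens (twist m) (diff N n).

Lemma tdiffDl n : {morph tdiff^~ n : x y / x + y}.
Proof. by move=> x y; rewrite /tdiff raddfD twistD !tensDl addrACA. Qed.

Lemma tdiffDr m : {morph tdiff m : x y / x + y}.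
Proof. by move=> x y; rewrite /tdiff raddfD !tensDr addrACA. Qed.

Lemma tdiff_homogl i m n : homog M i m ->
  tdiff m n = tens (diff M m) n + tens m (diff N n) *~ sgn i.
Proof. by move=> hm; rewrite /tdiff (twist_homog hm) tensMzl. Qed.

Lemma tdiffA m a n : tdiff (ract m a) n = tdiff m (a *: n).
Proof.
move: m a n; apply: tensor_balanced; [exact: tdiffDl|exact: tdiffDr|].
move=> i j k m a n hm ha hn.
rewrite (tdiff_homogl (a *: n) hm).
rewrite (tdiff_homogl n (homogMz _ (dgm_deg ha hm))).
rewrite raddfMz !(dgm_leibniz _ ha) tensDr tensMzr.
rewrite (tens_ract_homog _ (diff_deg hm) ha) (tens_ract_homog _ hm (diff_deg ha)).
rewrite (tens_ract_homog _ hm ha) !tensMzl !tensDl !tensMzl !mulrzDl -!mulrzA.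
rewrite addrA [X in _ = X + _]addrC; congr (_ *~ _ + _ *~ _ + _ *~ _);
  by rewrite !sgn_simp; do 2!case: (odd _).
Qed.

Definition tensor_diff : {additive T -> T} :=
  tensor_map tdiffDl tdiffDr tdiffA.

Lemma tensor_diffE i m n : homog M i m ->
  tensor_diff (tens m n) = tens (diff M m) n + tens m (diff N n) *~ sgn i.
Proof.
by move=> hm; rewrite [LHS](tensor_liftE tdiffDl tdiffDr tdiffA) (tdiff_homogl _ hm).
Qed.

Lemma tensor_comp_comp i j t :
  tensor_comp i (tensor_comp j t) = if i == j then tensor_comp j t else 0.
Proof.
move: t; apply: tensor_ind => [|x y hx hy|k l m n hm hn].
- by rewrite !raddf0 if_same.
- by rewrite !raddfD hx hy; case: eqP; rewrite ?addr0.
rewrite (tensor_compE j hm hn); case: (j =P k + l) => [->|_].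
  by rewrite (tensor_compE i hm hn).
by rewrite raddf0 if_same.
Qed.

Lemma tensor_comp_sum t :
  exists s : seq int, uniq s /\ t = \sum_(i <- s) tensor_comp i t.
Proof.
suff [s hs] : exists s : seq int, forall s', uniq s' -> {subset s <= s'} ->
    t = \sum_(i <- s') tensor_comp i t.
  exists (undup s); rewrite undup_uniq; split=> //.
  by apply: hs; rewrite ?undup_uniq // => i; rewrite mem_undup.
move: t; apply: tensor_ind => [|x y [s hs] [s' hs']|i j m n hm hn].
- by exists [::] => s _ _; rewrite big1 // => i _; rewrite raddf0.
- exists (s ++ s') => u uu su.
  under eq_bigr do rewrite raddfD.
  rewrite big_split /=; congr (_ + _).
    by apply: hs => // i si; apply: su; rewrite mem_cat si.
  by apply: hs' => // i si; apply: su; rewrite mem_cat si orbT.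
exists [:: i + j] => u uu su.
rewrite (bigD1_seq (i + j)) ?su ?mem_head //.
rewrite (tensor_compE _ hm hn) eqxx big1 => [|k /negPf kij]; first exact/esym/addr0.
by rewrite (tensor_compE _ hm hn) kij.
Qed.

Lemma tensor_diff_deg i t :
  tensor_comp i t = t -> tensor_comp (i - 1) (tensor_diff t) = tensor_diff t.
Proof.
suff h u : tensor_comp (i - 1) (tensor_diff u) = tensor_diff (tensor_comp i u).
  by move=> {2}<-; rewrite h.
move: u; apply: tensor_ind => [|x y hx hy|k l m n hm hn].
- by rewrite !raddf0.
- by rewrite !raddfD hx hy.
rewrite (tensor_compE i hm hn) (tensor_diffE _ hm) raddfD raddfMz.
rewrite (tensor_compE _ (diff_deg hm) hn) (tensor_compE _ hm (diff_deg hn)).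
rewrite addrAC addrA (inj_eq (addIr _)).
by case: eqP => _; rewrite ?(tensor_diffE _ hm) // mul0rz addr0 raddf0.
Qed.

Lemma tensor_diffK t : tensor_diff (tensor_diff t) = 0.
Proof.
move: t; apply: tensor_ind => [|x y hx hy|k l m n hm hn].
- by rewrite !raddf0.
- by rewrite !raddfD hx hy addr0.
rewrite (tensor_diffE _ hm) raddfD raddfMz.
rewrite (tensor_diffE _ (diff_deg hm)) (tensor_diffE _ hm).
rewrite !diffK tens0l tens0r mul0rz add0r addr0 -mulrzDr.
by rewrite !sgn_simp; case: (odd _).
Qed.

Definition tensor_complex : complex_on T :=
  ComplexOn tensor_comp_comp tensor_comp_sum tensor_diff_deg tensor_diffK.

(* The left action corresponding to (m (x) n) a = m (x) (n a), which is      *)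
(* tensor_ract below.                                                        *)
Definition tact (a : A) (m : M) (n : N) : T := tens (a *: m) n.

Lemma tactDl a n : {morph (tact a)^~ n : x y / x + y}.
Proof. by move=> x y; rewrite /tact scalerDr tensDl. Qed.

Lemma tactDr a m : {morph tact a m : x y / x + y}.
Proof. by move=> x y; rewrite /tact tensDr. Qed.

Lemma tactA a m b n : tact a (ract m b) n = tact a m (b *: n).
Proof.
move: a; apply: (@homog_ext _ A) => [x y|x y|||l a ha]; rewrite /tact.
- by rewrite scalerDl tensDl.
- by rewrite scalerDl tensDl.
- by rewrite scale0r tens0l.
- by rewrite scale0r tens0l.
move: m b n; apply: (tensor_balanced (tactDl a) (tactDr a)).
move=> i j k m b n hm hb hn; rewrite /tact.
rewrite (tens_ract_homog _ (dgm_deg ha hm) hb) -tensMzl; congr tens.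
rewrite -scalerMzr !scalerA (gcA ha hb) -scalerMzl.
rewrite -[b * a *: m]/(_) -!mulrzA; congr (_ *~ _).
by rewrite !sgn_simp; do 3!case: (odd _).
Qed.

Definition tensor_smul a : {additive T -> T} :=
  tensor_map (tactDl a) (tactDr a) (tactA a).

Lemma tensor_smulE a m n : tensor_smul a (tens m n) = tens (a *: m) n.
Proof. exact: (tensor_liftE (tactDl a) (tactDr a) (tactA a)). Qed.

Lemma tensor_smulA a b t :
  tensor_smul a (tensor_smul b t) = tensor_smul (a * b) t.
Proof.
move: t; apply: tensor_ind => [|x y hx hy|i j m n _ _]; rewrite ?raddf0 //.
  by rewrite !raddfD hx hy.
by rewrite !tensor_smulE scalerA.
Qed.

Lemma tensor_smul1 t : tensor_smul 1 t = t.
Proof.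
move: t; apply: tensor_ind => [|x y hx hy|i j m n _ _]; rewrite ?raddf0 //.
  by rewrite raddfD hx hy.
by rewrite tensor_smulE scale1r.
Qed.

Lemma tensor_smulDl t : {morph tensor_smul^~ t : a b / a + b}.
Proof.
move=> a b; move: t; apply: tensor_ind => [|x y hx hy|i j m n _ _].
- by rewrite !raddf0 addr0.
- by rewrite !raddfD hx hy addrACA.
by rewrite !tensor_smulE scalerDl tensDl.
Qed.

Definition tensor_action : scalar_action A T :=
  ScalarAction tensor_smulA tensor_smul1
    (fun a => raddfD (tensor_smul a)) tensor_smulDl.

Lemma tensor_dgmodule :
  @is_dgmodule R A (lmod_of tensor_action) tensor_complex.
Proof.
split=> [i j a t ha ht|i a t ha].
  suff h u : tensor_comp (i + j) (tensor_smul a u) =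
             tensor_smul a (tensor_comp j u).
    have ht' : tensor_comp j t = t := ht.
    by change (tensor_comp (i + j) (tensor_smul a t) = tensor_smul a t); rewrite h ht'.
  move: u; apply: tensor_ind => [|x y hx hy|k l m n hm hn].
  - by rewrite !raddf0.
  - by rewrite !raddfD hx hy.
  rewrite tensor_smulE (tensor_compE _ (dgm_deg ha hm) hn) (tensor_compE _ hm hn).
  by rewrite -addrA (inj_eq (addrI _)); case: eqP; rewrite ?tensor_smulE ?raddf0.
change (tensor_diff (tensor_smul a t) =
  tensor_smul (diff A a) t + tensor_smul a (tensor_diff t) *~ sgn i).
move: t; apply: tensor_ind => [|x y hx hy|k l m n hm hn].
- by rewrite !raddf0 mul0rz addr0.
- by rewrite !raddfD hx hy mulrzDl addrACA.
rewrite !tensor_smulE (tensor_diffE _ hm) (tensor_diffE _ (dgm_deg ha hm)).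
rewrite raddfD raddfMz !tensor_smulE (dgm_leibniz _ ha) tensDl tensMzl.
rewrite mulrzDl -!mulrzA addrA; congr (_ + _ *~ _).
by rewrite !sgn_simp; do 2!case: (odd _).
Qed.

Definition tensor : dgModule A :=
  @DGModule R A (lmod_of tensor_action) tensor_complex tensor_dgmodule.

Lemma tensor_ract i j k m n a :
  homog M i m -> homog N j n -> homog A k a ->
  ract (tens m n : tensor) a = tens m (ract n a).
Proof.
move=> hm hn ha; rewrite (ract_homog hn ha) tensMzr (tens_ract_homog _ hm ha).
have hmn : homog tensor (i + j) (tens m n : tensor).
  by change (tensor_comp (i + j) (tens m n) = tens m n);
     rewrite (tensor_compE _ hm hn) eqxx.
rewrite (ract_homog hmn ha) -[a *: _]/(tensor_smul a (tens m n)) tensor_smulE.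
rewrite -!mulrzA; congr (_ *~ _).
by rewrite !sgn_simp; do 3!case: (odd _).
Qed.

End TensorDGModule.

Section Cone.
Variables (R : comPzRingType) (A B : dgAlgebra R).

(* B_(>=1) (+) A_(>=1) *)
Definition pos_pair : {pred B * A} :=
  fun x => (comp B 0 x.1 == 0) && (comp A 0 x.2 == 0).

Lemma pos_pair_zmod : zmod_closed pos_pair.
Proof.
split=> [|x y /andP[/eqP x1 /eqP x2] /andP[/eqP y1 /eqP y2]]; apply/andP.
  by rewrite /= !raddf0 !eqxx.
by split; rewrite /= raddfB ?x1 ?x2 ?y1 ?y2 subrr.
Qed.

HB.instance Definition _ :=
  GRing.isZmodClosed.Build (B * A)%type pos_pair pos_pair_zmod.

(* Elements (b, c) of M = Cone(alpha_(>=1))[1].  As B_i = A_i = 0 for i < 0, *)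
(* the degree i part is B_(i+1) (+) A_i for i >= 1, and B_1 (+) 0 for i = 0; in *)
(* particular b has degree i + 1 in B when (b, c) has degree i in M.         *)
Record cone := Cone {
  cone_val :> (B * A)%type;
  cone_valP : cone_val \in pos_pair
}.

HB.instance Definition _ := [isSub for cone_val].
HB.instance Definition _ := [Choice of cone by <:].
HB.instance Definition _ := [SubChoice_isSubZmodule of cone by <:].


Definition cone_comp_fun (i : int) (m : cone) : B * A :=
  (comp B (i + 1) m.1, comp A i m.2).

Lemma cone_comp_subproof i m : cone_comp_fun i m \in pos_pair.
Proof.
have /andP[/eqP m1 /eqP m2] := cone_valP m.
apply/andP; rewrite /= !comp_comp; split.
  by case: (0 =P i + 1) => // <-; rewrite m1.
by case: (0 =P i) => // <-; rewrite m2.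
Qed.

Definition cone_comp i (m : cone) : cone := Cone (cone_comp_subproof i m).

Lemma cone_comp_additive i : zmod_morphism (cone_comp i).
Proof.
by move=> m n; apply: val_inj; rewrite /= /cone_comp_fun /= !raddfB.
Qed.

HB.instance Definition _ i :=
  GRing.isZmodMorphism.Build cone cone (cone_comp i) (cone_comp_additive i).

Lemma cone_comp_comp i j m :
  cone_comp i (cone_comp j m) = if i == j then cone_comp j m else 0.
Proof.
apply: val_inj; rewrite /= /cone_comp_fun /= !comp_comp (inj_eq (addIr _)).
by case: eqP.
Qed.

Lemma cone_comp_sum m :
  exists s : seq int, uniq s /\ m = \sum_(i <- s) cone_comp i m.
Proof.
have [s [us sE]] : exists s : seq int, uniq s /\
    forall i, i \notin s -> (comp B (i + 1) m.1 = 0) /\ (comp A i m.2 = 0).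
  exists (undup ([seq i - 1 | i <- supp B m.1] ++ supp A m.2)).
  rewrite undup_uniq; split=> // i; rewrite mem_undup mem_cat negb_or.
  case/andP=> h1 /supp_out h2; split=> //; apply: supp_out.
  by apply: contra h1 => h; apply/mapP; exists (i + 1); rewrite // addrK.
exists s; split=> //; apply: val_inj; rewrite raddf_sum /=.
rewrite /cone_comp_fun; case: (cone_val m) sE => b c /= sE.
have eta (u : B * A) : u = (u.1, u.2) by case: u.
rewrite [RHS]eta !raddf_sum /=; congr (_, _).
  have sB i : i \notin [seq j + 1 | j <- s] -> comp B i b = 0.
    move=> h; have /sE[] : i - 1 \notin s; last by rewrite subrK.
    by apply: contra h => h; apply/mapP; exists (i - 1); rewrite // subrK.
  have := @hsumE _ B _ (fun _ => id) (fun=> erefl) b _ _ sB.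
  by rewrite /hsum -supp_sum big_map; apply; rewrite map_inj_uniq //; exact: addIr.
have sA i : i \notin s -> comp A i c = 0 by case/sE.
have := @hsumE _ A _ (fun _ => id) (fun=> erefl) c _ us sA.
by rewrite /hsum -supp_sum.
Qed.

(* The component of x in positive degrees, for x in non-negative degrees. *)
Definition trunc (V : zmodType) (C : complex_on V) (x : V) : V :=
  x - comp C 0 x.

Lemma comp_trunc (V : zmodType) (C : complex_on V) i x :
  comp C i (trunc C x) = if i == 0 then 0 else comp C i x.
Proof.
rewrite /trunc raddfB comp_comp.
by case: eqP => [->|_]; rewrite ?subrr // subr0.
Qed.

Lemma truncB (V : zmodType) (C : complex_on V) : zmod_morphism (trunc C).
Proof. by move=> x y; rewrite /trunc raddfB !opprD !opprK addrACA. Qed.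

HB.instance Definition _ (V : zmodType) (C : complex_on V) :=
  GRing.isZmodMorphism.Build V V (trunc C) (truncB C).

Lemma diff_comp0 (D : dgAlgebra R) (x : D) : diff D (comp D 0 x) = 0.
Proof.
rewrite -diff_comp; apply: (@dga_ge0 _ D (0 - 1)) => //; exact: homog_comp.
Qed.

Lemma diff_trunc (D : dgAlgebra R) (x : D) : diff D (trunc D x) = diff D x.
Proof. by rewrite /trunc raddfB diff_comp0 subr0. Qed.

Variable alpha : dgHom A B.

Lemma alpha_comp i a : alpha (comp A i a) = comp B i (alpha a).
Proof.
move: a; apply: (@homog_ext _ A) => [x y|x y|||j a ha];
  rewrite ?raddfD ?raddf0 //.
rewrite (comp_homog _ ha) (comp_homog _ (dgh_deg alpha ha)).
by case: eqP; rewrite ?raddf0.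
Qed.

(* trunc discards the differential out of degree 1 in B_(>=1) and A_(>=1). *)
Definition cone_diff_fun (m : cone) : B * A :=
  (trunc B (- diff B m.1 - alpha m.2), trunc A (diff A m.2)).

Lemma cone_diff_subproof m : cone_diff_fun m \in pos_pair.
Proof. by apply/andP; rewrite /= !comp_trunc !eqxx. Qed.

Definition cone_diff (m : cone) : cone := Cone (cone_diff_subproof m).

Lemma cone_diff_additive : zmod_morphism cone_diff.
Proof.
move=> m n; apply: val_inj; rewrite /= /cone_diff_fun /=.
congr (_, _); last first.
  by rewrite -[RHS]/(trunc A (diff A m.2) - trunc A (diff A n.2)) !raddfB.
rewrite -[RHS]/(trunc B (- diff B m.1 - alpha m.2) -
                trunc B (- diff B n.1 - alpha n.2)).
rewrite -[RHS]raddfB; congr (trunc B _).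
by rewrite (raddfB (diff B)) (raddfB alpha) !opprD !opprK addrACA.
Qed.

HB.instance Definition _ :=
  GRing.isZmodMorphism.Build cone cone cone_diff cone_diff_additive.

Lemma cone_diff_deg i m :
  cone_comp i m = m -> cone_comp (i - 1) (cone_diff m) = cone_diff m.
Proof.
move=> hm; apply: val_inj; rewrite /= /cone_comp_fun /= /cone_diff_fun.
have [hb hc] : comp B (i + 1) m.1 = m.1 /\ comp A i m.2 = m.2.
  by rewrite -{2 4}hm.
have hdb : comp B i (- diff B m.1 - alpha m.2) = - diff B m.1 - alpha m.2.
  by rewrite raddfB raddfN -alpha_comp hc -{1}(addrK 1 i) diff_comp hb.
have hdc : comp A (i - 1) (diff A m.2) = diff A m.2 by rewrite diff_comp hc.
have homog_trunc (V : zmodType) (C : complex_on V) j x :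
    comp C j x = x -> comp C j (trunc C x) = trunc C x.
  by move=> hx; rewrite /trunc raddfB comp_comp (comp_homog 0 hx) eq_sym;
     case: eqP; rewrite hx ?raddf0.
by rewrite subrK (homog_trunc _ _ _ _ hdb) (homog_trunc _ _ _ _ hdc).
Qed.

Lemma cone_diffK m : cone_diff (cone_diff m) = 0.
Proof.
apply: val_inj; rewrite /= /cone_diff_fun /= !diff_trunc diffK raddf0.
rewrite (raddfB (diff B)) (raddfN (diff B)) diffK oppr0 sub0r opprK.
rewrite -dgh_diff [trunc A (diff A _)]/trunc rmorphB alpha_comp opprB addrC subrK.
by rewrite -[RHS]/(0, 0) /trunc comp_comp subrr.
Qed.

Definition cone_complex : complex_on cone :=
  ComplexOn cone_comp_comp cone_comp_sum cone_diff_deg cone_diffK.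

End Cone.

(* Main.v *)
(* Every element m of the cone is determined by its B-component b and by      *)
(* x = beta(m), subject only to b having positive degree and to x and d b     *)
(* having the same component in degree 0.  The case distinctions between      *)
(* degree 0 and positive degree disappear in terms of (b, x): the module      *)
(* structure is componentwise up to sign, beta is the second projection, and  *)
(* mu((b, x) (x) (d, y)) = (+- b d, 0).  All identities then reduce to the    *)
(* Leibniz rule and graded commutativity in A and B.                          *)
Require Import Defs.
From HB Require Import structures.
From mathcomp Require Import all_boot all_order all_algebra.
From mathcomp Require Import zify.

Set Implicit Arguments.
Unset Strict Implicit.
Unset Printing Implicit Defensive.

Import GRing.Theory.
Local Open Scope ring_scope.

(** Up to the sign of the A-coordinate, M is the truncation to degrees >= 0 of the shifted cone of
    the whole map alpha. That cone has B_0 in degree -1, and its degree 0 cycles are the pairs (b,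
    x) in B_1 (+) A_0 with d b = alpha x; since A_0 = B_0 = R, such a pair is determined by b. So M
    is the set of pairs with b_0 = 0 and x_0 = (d b)_0 in R, and only this condition has to be
    checked for the action and mu to be well defined ([cone_beta_smul], [cone_beta_mu]). It survives
    because, in non-negative degrees, projection to degree 0 is multiplicative ([dga_baseM]), whence
    [dga_base_diffM].

    For the homotopy take m = (b, x) and n = (b', x'). In d mu + mu d the Leibniz rule cancels all
    terms in d b and d b'. What is left comes from the alpha-part of the differential of M, namely b
    alpha(x') and alpha(x) b' up to sign, the B-coordinates of m beta(n) and beta(m) n. The
    A-coordinates of these two agree by graded commutativity of A ([cone_theta_homog]). The
    remaining identities for mu are sign counts, b having degree |m| + 1. *)

Local Notation comp := Defs.comp.

(** * Projection to degree 0 and the grading involution of a dg algebra *)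

Section GradedAlgebra.
Variables (R : comPzRingType) (D : dgAlgebra R).
Implicit Types (x y : D) (i j : int).

Lemma dga_unit_inj : injective (dga_unit D).
Proof. exact: can_inj (@dga_unitK R D). Qed.

Lemma homog_unit r : homog D 0 (dga_unit D r).
Proof. by rewrite /homog -dga_baseK dga_unitK. Qed.

Lemma homog1 : homog D 0 1.
Proof. by rewrite -(rmorph1 (dga_unit D)); exact: homog_unit. Qed.

Lemma diff_unit r : diff D (dga_unit D r) = 0.
Proof. by rewrite -(homog_unit r) diff_comp0. Qed.

Lemma dga_base_additive : zmod_morphism (@dga_base R D).
Proof. by move=> x y; apply: dga_unit_inj; rewrite rmorphB !dga_baseK raddfB. Qed.

HB.instance Definition _ :=
  GRing.isZmodMorphism.Build D R (@dga_base R D) dga_base_additive.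

Lemma dga_base_eq0 x : comp D 0 x = 0 -> dga_base x = 0.
Proof. by move=> x0; apply: dga_unit_inj; rewrite dga_baseK x0 raddf0. Qed.

Lemma comp0_homog i x : homog D i x -> i != 0 -> comp D 0 x = 0.
Proof. by move=> hx i0; rewrite (comp_homog _ hx) eq_sym (negPf i0). Qed.

Lemma dga_base_homog i x : homog D i x -> i != 0 -> dga_base x = 0.
Proof. by move=> hx i0; exact/dga_base_eq0/(comp0_homog hx). Qed.

(** Degrees are non-negative, so i + j = 0 forces i = j = 0. *)
Lemma comp0M x y : comp D 0 (x * y) = comp D 0 x * comp D 0 y.
Proof.
move: x; apply: (@homog_ext _ D) => [u v|u v|||i x hx];
  rewrite ?mulrDl ?raddfD ?raddf0 ?mul0r ?raddf0 ?mulrDl //.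
move: y; apply: (@homog_ext _ D) => [u v|u v|||j y hy];
  rewrite ?mulrDr ?raddfD ?raddf0 ?mulr0 ?raddf0 ?mulrDr //.
have [i0|i0] := boolP (i < 0).
  by rewrite (dga_ge0 i0 hx) mul0r raddf0 mul0r.
have [j0|j0] := boolP (j < 0).
  by rewrite (dga_ge0 j0 hy) mulr0 raddf0 mulr0.
rewrite (comp_homog _ hx) (comp_homog _ hy) (comp_homog _ (dga_mul_deg hx hy)).
case: eqP => [e|e]; first by rewrite ifT ?ifT //; lia.
case: eqP => e1; last by rewrite mul0r.
by case: eqP => e2; [lia|rewrite mulr0].
Qed.

Lemma dga_baseM x y : dga_base (x * y) = dga_base x * dga_base y.
Proof. by apply: dga_unit_inj; rewrite rmorphM !dga_baseK comp0M. Qed.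

(** The grading involution. With it the Koszul signs of the Leibniz rule, the action and mu can be
    written for inhomogeneous elements too. *)
Definition gsign x : D := hsum D (fun i u => u *~ sgn i) x.

Lemma gsign_homog i x : homog D i x -> gsign x = x *~ sgn i.
Proof. by move=> hx; rewrite /gsign (hsum_homog _ hx) // => j; rewrite mul0rz. Qed.

Lemma gsignD : {morph gsign : x y / x + y}.
Proof. by apply: hsumD => [i|i x y]; rewrite ?mul0rz ?mulrzDl. Qed.

Lemma gsign0 : gsign 0 = 0.
Proof. by apply: (addrI (gsign 0)); rewrite -gsignD !addr0. Qed.

Lemma gsignB : zmod_morphism gsign.
Proof. by move=> x y; apply: (addIr (gsign y)); rewrite -gsignD !subrK. Qed.

Lemma gsignN x : gsign (- x) = - gsign x.
Proof. by rewrite -[- x]sub0r gsignB gsign0 sub0r. Qed.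

Lemma gsign1 : gsign 1 = 1.
Proof. by rewrite (gsign_homog homog1). Qed.

Lemma gsignM x y : gsign (x * y) = gsign x * gsign y.
Proof.
move: x; apply: (@homog_ext _ D) => [u v|u v|||i x hx];
  rewrite ?mulrDl ?gsignD ?mul0r ?gsign0 ?mul0r ?mulrDl //.
move: y; apply: (@homog_ext _ D) => [u v|u v|||j y hy];
  rewrite ?mulrDr ?gsignD ?mulr0 ?gsign0 ?mulr0 ?mulrDr //.
rewrite (gsign_homog hx) (gsign_homog hy) (gsign_homog (dga_mul_deg hx hy)).
rewrite mulrzAl mulrzAr -mulrzA; congr (_ *~ _).
by rewrite !sgn_simp; do 2!case: (odd _).
Qed.

Lemma dga_base_gsign x : dga_base (gsign x) = dga_base x.
Proof.
move: x; apply: (@homog_ext _ D) => [u v|u v|||i x hx];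
  rewrite ?gsignD ?raddfD ?gsign0 ?raddf0 //.
rewrite (gsign_homog hx) raddfMz /=.
have [->|i0] := eqVneq i 0; first by rewrite mulr1z.
by rewrite (dga_base_homog hx i0) mul0rz.
Qed.

Lemma diffM x y : diff D (x * y) = diff D x * y + gsign x * diff D y.
Proof.
move: x; apply: (@homog_ext _ D) => [u v|u v|||i x hx].
- by rewrite mulrDl raddfD.
- by rewrite raddfD gsignD !mulrDl addrACA.
- by rewrite mul0r raddf0.
- by rewrite raddf0 gsign0 !mul0r addr0.
by rewrite (dga_leibniz _ hx) (gsign_homog hx) mulrzAl.
Qed.

(** The Leibniz term d x * y has no degree 0 part because y has none. This is what keeps the action
    and mu inside the cone. *)
Lemma dga_base_diffM x y : comp D 0 y = 0 ->
  dga_base (diff D (x * y)) = dga_base x * dga_base (diff D y).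
Proof.
move=> y0; rewrite diffM raddfD /= !dga_baseM dga_base_gsign.
by rewrite (dga_base_eq0 y0) mulr0 add0r.
Qed.

Lemma gsign_diff x : gsign (diff D x) = - diff D (gsign x).
Proof.
move: x; apply: (@homog_ext _ D) => [u v|u v|||i x hx].
- by rewrite raddfD gsignD.
- by rewrite gsignD raddfD opprD.
- by rewrite raddf0 gsign0.
- by rewrite gsign0 raddf0 oppr0.
rewrite (gsign_homog hx) (gsign_homog (diff_deg hx)) raddfMz -mulNrz -mulrN1z -mulrzA.
by congr (_ *~ _); rewrite !sgn_simp; case: (odd _).
Qed.

Lemma gsignK x : gsign (gsign x) = x.
Proof.
move: x; apply: (@homog_ext _ D) => [u v|u v|||i x hx];
  rewrite ?gsignD ?gsign0 //.
rewrite (gsign_homog hx) (gsign_homog (homogMz _ hx)) -mulrzA.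
by rewrite !sgn_simp; case: (odd _).
Qed.

Lemma homog_gsign i x : homog D i x -> homog D i (gsign x).
Proof. by move=> hx; rewrite (gsign_homog hx); exact: homogMz. Qed.

End GradedAlgebra.

(** * The cone in the coordinates (b, x): action, beta and mu *)

Section ConeModule.
Variables (R : comPzRingType) (A B : dgAlgebra R).
Implicit Types (m n u : cone A B) (i j : int) (a x : A) (b : B).

Lemma cone_comp0l m : comp B 0 m.1 = 0.
Proof. by have /andP[/eqP] := cone_valP m. Qed.

Lemma cone_comp0r m : comp A 0 m.2 = 0.
Proof. by have /andP[_ /eqP] := cone_valP m. Qed.

(* In the coordinates (b, x), x = cone_beta m, one has in all degrees         *)
(* d(b, x) = (alpha x - d b, d x) and a (b, x) = (alpha (gsign a) b, a x).    *)
Definition cone_beta m : A := dga_unit A (dga_base (diff B m.1)) - m.2.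

Lemma cone_beta_additive : zmod_morphism cone_beta.
Proof.
move=> m n; rewrite /cone_beta -[(m - n).1]/(m.1 - n.1) -[(m - n).2]/(m.2 - n.2).
by rewrite !raddfB /= addrACA.
Qed.

HB.instance Definition _ :=
  GRing.isZmodMorphism.Build (cone A B) A cone_beta cone_beta_additive.

Lemma base_cone_beta m : dga_base (cone_beta m) = dga_base (diff B m.1).
Proof. by rewrite raddfB /= dga_unitK (dga_base_eq0 (cone_comp0r m)) subr0. Qed.

Lemma cone_betaK m : - trunc A (cone_beta m) = m.2.
Proof.
rewrite /trunc -dga_baseK base_cone_beta /cone_beta.
by rewrite addrAC subrr sub0r opprK.
Qed.

Lemma cone_ext m n : m.1 = n.1 -> cone_beta m = cone_beta n -> m = n.
Proof.
move=> e1 e2; apply: val_inj => /=.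
rewrite (surjective_pairing (cone_val m)) (surjective_pairing (cone_val n)).
by rewrite e1 -!cone_betaK e2.
Qed.

Lemma coneD1 m n : (m + n).1 = m.1 + n.1.
Proof. by []. Qed.

Lemma coneN1 m : (- m).1 = - m.1.
Proof. by []. Qed.

Lemma coneB1 m n : (m - n).1 = m.1 - n.1.
Proof. by []. Qed.

Lemma coneMz1 m z : (m *~ z).1 = m.1 *~ z.
Proof.
by rewrite -[(m *~ z).1]/((fst \o \val : {additive cone A B -> B}) (m *~ z)) raddfMz.
Qed.

Lemma cone_mk_subproof (p : B * A) : (trunc B p.1, - trunc A p.2) \in @pos_pair R A B.
Proof. by apply/andP; rewrite /= raddfN !comp_trunc eqxx oppr0 !eqxx. Qed.

(** Truncating makes this total; it has coordinates (b, x) only when b_0 = 0 and x_0 = (d b)_0, as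
    in [cone_mk1] and [cone_beta_mk]. *)
Definition cone_mk b x : cone A B := Cone (cone_mk_subproof (b, x)).

Lemma cone_mk1 b x : comp B 0 b = 0 -> (cone_mk b x).1 = b.
Proof. by rewrite /= /trunc => ->; rewrite subr0. Qed.

Lemma cone_beta_mk b x : dga_base x = dga_base (diff B b) ->
  cone_beta (cone_mk b x) = x.
Proof.
by move=> e; rewrite /cone_beta /= diff_trunc opprK -e /trunc dga_baseK addrC subrK.
Qed.

Variable alpha : dgHom A B.
Local Notation C := (cone_complex alpha).

Lemma cone_homogP i m :
  homog C i m <-> homog B (i + 1) m.1 /\ homog A i (cone_beta m).
Proof.
split=> [hm|[h1 h2]].
  have [h1 h2] : comp B (i + 1) m.1 = m.1 /\ comp A i m.2 = m.2.
    by rewrite -{2 4}(hm : cone_comp i m = m).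
  split=> //; rewrite /homog raddfB /= h2; congr (_ - _).
  have := diff_deg h1; rewrite addrK => h3.
  have [->|i0] := eqVneq i 0; first exact: homog_unit.
  by rewrite (dga_base_homog h3 i0) !raddf0.
suff : cone_comp i m = m by [].
apply: val_inj; rewrite /= /cone_comp_fun (h1 : comp B (i + 1) m.1 = m.1).
rewrite [RHS]surjective_pairing; congr pair.
rewrite -cone_betaK raddfN comp_trunc /trunc h2 (comp_homog 0 h2) eq_sym.
by case: eqP; rewrite ?subrr ?subr0.
Qed.

Lemma cone_homog0 m : homog C 0 m -> m.2 = 0.
Proof.
move=> hm; rewrite -(cone_comp0r m).
by rewrite -{1}(hm : cone_comp 0 m = m).
Qed.

Lemma dga_base_diff_cone i m : homog C i m -> 1 <= i ->
  dga_base (diff B m.1) = 0.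
Proof.
move=> /cone_homogP[/diff_deg hb _] i1; apply: (dga_base_homog hb); lia.
Qed.

Lemma dga_base_hom a : dga_base (alpha a) = dga_base a.
Proof.
apply: (@dga_unit_inj _ B); rewrite dga_baseK -alpha_comp -dga_baseK.
exact: dgh_unit.
Qed.

Lemma alpha_gsign a : alpha (gsign a) = gsign (alpha a).
Proof.
move: a; apply: (@homog_ext _ A) => [x y|x y|||i a ha];
  rewrite ?gsignD ?raddfD ?gsign0 ?raddf0 ?gsignD ?gsign0 //.
by rewrite (gsign_homog ha) (gsign_homog (dgh_deg alpha ha)) raddfMz.
Qed.

(** The degree 0 part of d b that [trunc] discards is exactly the image under alpha of the A_0-part
    of [cone_beta m]. *)
Lemma cone_diff1 m : (cone_diff alpha m).1 = alpha (cone_beta m) - diff B m.1.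
Proof.
rewrite /= /trunc raddfB raddfN /= -alpha_comp cone_comp0r raddf0 subr0 opprK.
by rewrite /cone_beta raddfB /= dgh_unit dga_baseK addrC addrA addrAC.
Qed.

Lemma cone_beta_diff m : cone_beta (cone_diff alpha m) = diff A (cone_beta m).
Proof.
rewrite {1}/cone_beta cone_diff1 (raddfB (diff B)) diffK subr0 -dgh_diff.
rewrite dga_base_hom dga_baseK /=.
rewrite /cone_beta (raddfB (diff A)) diff_unit sub0r.
by rewrite raddfN /trunc opprB addKr.
Qed.

Definition cone_smul a m : cone A B :=
  cone_mk (alpha (gsign a) * m.1) (a * cone_beta m).

Lemma cone_smul1 a m : (cone_smul a m).1 = alpha (gsign a) * m.1.
Proof. by rewrite cone_mk1 // comp0M cone_comp0l mulr0. Qed.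

Lemma cone_beta_smul a m : cone_beta (cone_smul a m) = a * cone_beta m.
Proof.
rewrite cone_beta_mk // dga_baseM base_cone_beta dga_base_diffM ?cone_comp0l //.
by rewrite dga_base_hom dga_base_gsign.
Qed.

(** Returns to the original coordinate c. The correction term vanishes for |m| >= 1, where d b has
    no degree 0 part, and for a in A_0, where [trunc A a] is 0; for |m| = 0 and |a| >= 1 it is the
    whole value -a d(m). *)
Lemma cone_smul2 a m :
  (cone_smul a m).2 = a * m.2 - trunc A a * dga_unit A (dga_base (diff B m.1)).
Proof.
rewrite -cone_betaK cone_beta_smul /cone_beta mulrBr /trunc (raddfB (comp A 0)) !comp0M.
by rewrite cone_comp0r mulr0 subr0 homog_unit mulrBl !opprB addrCA.
Qed.

Lemma cone_smul_val i a m : homog A i a ->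
  cone_val (cone_smul a m) = ((alpha a * m.1) *~ sgn i,
    a * m.2 - trunc A a * dga_unit A (dga_base (diff B m.1))).
Proof.
move=> ha; rewrite [LHS]surjective_pairing cone_smul1 cone_smul2.
by rewrite (gsign_homog ha) raddfMz mulrzAl.
Qed.

Lemma cone_smulA a x m : cone_smul a (cone_smul x m) = cone_smul (a * x) m.
Proof.
apply: cone_ext; first by rewrite !cone_smul1 gsignM rmorphM mulrA.
by rewrite !cone_beta_smul mulrA.
Qed.

Lemma cone_smul_1 m : cone_smul 1 m = m.
Proof.
apply: cone_ext; first by rewrite cone_smul1 gsign1 rmorph1 mul1r.
by rewrite cone_beta_smul mul1r.
Qed.

Lemma cone_smulDr a : {morph cone_smul a : m n / m + n}.
Proof.
move=> m n; apply: cone_ext; last by rewrite raddfD /= !cone_beta_smul raddfD mulrDr.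
rewrite cone_smul1 -[(m + n).1]/(m.1 + n.1) mulrDr -!cone_smul1.
by [].
Qed.

Lemma cone_smulDl m : {morph cone_smul^~ m : a x / a + x}.
Proof.
move=> a x; apply: cone_ext; last by rewrite raddfD /= !cone_beta_smul mulrDl.
by rewrite cone_smul1 gsignD rmorphD mulrDl -!cone_smul1.
Qed.

Definition cone_action : scalar_action A (cone A B) :=
  ScalarAction cone_smulA cone_smul_1 cone_smulDr cone_smulDl.

Lemma cone_dgmodule : @is_dgmodule R A (lmod_of cone_action) C.
Proof.
split=> [i j a m ha /cone_homogP[hb hx]|i a m ha].
  apply/cone_homogP; rewrite [_ *: _]/(cone_smul a m) cone_smul1 cone_beta_smul.
  split; last exact: dga_mul_deg.
  by rewrite -addrA; apply: dga_mul_deg => //; apply/dgh_deg/homog_gsign.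
rewrite -[LHS]/(cone_diff alpha (cone_smul a m)).
rewrite -[RHS]/(cone_smul (diff A a) m + cone_smul a (cone_diff alpha m) *~ sgn i).
apply: cone_ext.
  rewrite coneD1 coneMz1 !cone_smul1 !cone_diff1 cone_smul1 cone_beta_smul.
  rewrite diffM -alpha_gsign gsignK gsign_diff -dgh_diff -mulrzAl -raddfMz.
  (* The Leibniz sign is absorbed: (-1)^i times [gsign a] is [gsign] applied twice, which is a. *)
  rewrite -(gsign_homog (homog_gsign ha)) gsignK.
  rewrite (rmorphM alpha) (raddfN alpha) mulrBr mulNr.
  by rewrite opprD addrA [RHS]addrA; congr (_ - _); exact: addrC.
rewrite raddfD raddfMz /= !(cone_beta_smul, cone_beta_diff).
exact: dga_leibniz.
Qed.

Definition cone_module : dgModule A := DGModule cone_dgmodule.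

Lemma cone_beta_linear : @Alinear R A cone_module (regular A) 0 cone_beta.
Proof.
split=> [i m /cone_homogP[_]|i a m ha]; first by rewrite addr0.
by rewrite mulr0 mulr1z; exact: cone_beta_smul.
Qed.

Definition cone_beta_hom : dgModHom cone_module (regular A) :=
  @DGModHom R A cone_module (regular A) cone_beta cone_beta_linear cone_beta_diff.

(** One formula for all four cases: when |m| = 0, b has degree 1 and the two signs cancel to give +
    m n. *)
Definition cone_mu m n : cone A B := cone_mk (- (gsign m.1 * n.1)) 0.

Lemma cone_mu1 m n : (cone_mu m n).1 = - (gsign m.1 * n.1).
Proof. by rewrite cone_mk1 // raddfN comp0M cone_comp0l mulr0 oppr0. Qed.

(** A product of two elements of positive degree lives in degrees >= 2, so its boundary has no
    degree 0 part and 0 is an admissible second coordinate. *)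
Lemma cone_beta_mu m n : cone_beta (cone_mu m n) = 0.
Proof.
rewrite cone_beta_mk // raddf0 /= (raddfN (diff B)) raddfN /=.
rewrite dga_base_diffM ?cone_comp0l // dga_base_gsign.
by rewrite (dga_base_eq0 (cone_comp0l m)) mul0r oppr0.
Qed.

Lemma cone_mu_val m n : cone_val (cone_mu m n) = (- (gsign m.1 * n.1), 0).
Proof.
by rewrite [LHS]surjective_pairing cone_mu1 -cone_betaK cone_beta_mu raddf0 oppr0.
Qed.

Lemma cone_muDl n : {morph cone_mu^~ n : x y / x + y}.
Proof.
move=> x y; apply: cone_ext; last by rewrite raddfD /= !cone_beta_mu addr0.
by rewrite coneD1 !cone_mu1 coneD1 gsignD mulrDl opprD.
Qed.

Lemma cone_muDr m : {morph cone_mu m : x y / x + y}.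
Proof.
move=> x y; apply: cone_ext; last by rewrite raddfD /= !cone_beta_mu addr0.
by rewrite coneD1 !cone_mu1 coneD1 mulrDr opprD.
Qed.

Lemma gsign_cone i m : homog C i m -> gsign m.1 = m.1 *~ sgn (i + 1).
Proof. by move=> /cone_homogP[/gsign_homog]. Qed.

Lemma cone_mu_deg i j m n : homog C i m -> homog C j n ->
  homog C (i + j + 1) (cone_mu m n).
Proof.
move=> /cone_homogP[hb _] /cone_homogP[hd _]; apply/cone_homogP; split.
  rewrite cone_mu1 -mulrN1z; apply: homogMz.
  have -> : i + j + 1 + 1 = (i + 1) + (j + 1) by lia.
  exact: dga_mul_deg (homog_gsign hb) hd.
by rewrite cone_beta_mu; exact: homog0.
Qed.

Lemma cone_mu_smul i a m n : homog A i a ->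
  cone_mu (cone_smul a m) n = cone_smul a (cone_mu m n) *~ sgn i.
Proof.
move=> ha; apply: cone_ext; last first.
  by rewrite raddfMz /= cone_beta_smul !cone_beta_mu mulr0 mul0rz.
rewrite coneMz1 cone_smul1 !cone_mu1 cone_smul1 gsignM -!alpha_gsign gsignK.
by rewrite -mulrzAl -raddfMz -(gsign_homog (homog_gsign ha)) gsignK mulrN mulrA.
Qed.

Hypothesis gcB : graded_commutative B.

Lemma cone_muA (m : cone_module) a (n : cone_module) :
  cone_mu (ract m a) n = cone_mu m (a *: n).
Proof.
move: m a n; apply: tensor_balanced; [exact: cone_muDl|exact: cone_muDr|].
move=> i j k m a n hm ha hn.
apply: cone_ext; last by rewrite !cone_beta_mu.
rewrite -[_ *: m]/(cone_smul a m) -[_ *: n]/(cone_smul a n).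
rewrite !cone_mu1 coneMz1 !cone_smul1.
have [hb _] := (cone_homogP _ _).1 hm; have hb' := homog_gsign hb.
have ha' : homog B j (alpha (gsign a)) by apply/dgh_deg/homog_gsign.
rewrite (gsign_homog (homogMz _ (dga_mul_deg ha' hb))) (gsign_homog hb).
rewrite !mulrzAl mulrA (gcB hb ha') mulrzAl -!mulrzA; congr (- (_ *~ _)).
by rewrite !sgn_simp; do 2!case: (odd _).
Qed.

End ConeModule.

(** * mu on the tensor product, the homotopy for theta, and the identities for mu *)

Section ConeProduct.
Variables (R : comPzRingType) (A B : dgAlgebra R).
Hypotheses (gcA : graded_commutative A) (gcB : graded_commutative B).
Variable alpha : dgHom A B.
Local Notation C := (cone_complex alpha).
Local Notation M := (cone_module alpha).
Local Notation T := (tensor gcA M M).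
Implicit Types (m n u : M) (i j k : int).

Let muDl (n : M) : {morph (fun m : M => cone_mu m n : M) : x y / x + y} :=
  cone_muDl n.
Let muDr (m : M) : {morph (fun n : M => cone_mu m n : M) : x y / x + y} :=
  cone_muDr m.

Definition cone_product : {additive T -> M} :=
  tensor_map muDl muDr (cone_muA gcB).

Lemma cone_productE m n : cone_product (tens m n : T) = cone_mu m n.
Proof. exact: (tensor_liftE muDl muDr (cone_muA gcB)). Qed.

Lemma cone_product_linear : Alinear 1 cone_product.
Proof.
split=> [i x|i a x ha].
  (* Stated for all y, compatibility with the projections is additive and can be checked on
     elementary tensors. *)
  suff h (y : T) : comp M (i + 1) (cone_product y) = cone_product (comp T i y).
    by move=> hx; rewrite /homog h hx.
  move: y; apply: tensor_ind => [|x' y' hx hy|k l m n hm hn].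
  - by rewrite !raddf0.
  - by rewrite !raddfD hx hy.
  rewrite cone_productE (comp_homog _ (cone_mu_deg hm hn)) (inj_eq (addIr 1)).
  rewrite -[comp T i _]/(tensor_comp M M i (tens m n)) (tensor_compE _ hm hn).
  by case: eqP; rewrite ?raddf0 ?cone_productE.
rewrite -[a *: x]/(tensor_smul gcA M M a x).
move: x; apply: tensor_ind => [|x y hx hy|k l m n hm hn].
- by rewrite !raddf0 mul0rz.
- by rewrite !raddfD hx hy mulrzDl.
by rewrite tensor_smulE !cone_productE mulr1; exact: cone_mu_smul.
Qed.

Lemma cone_beta_product x : cone_beta (cone_product x) = 0.
Proof.
move: x; apply: tensor_ind => [|x y hx hy|i j m n _ _].
- by rewrite !raddf0.
- by rewrite !raddfD /= hx hy addr0.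
by rewrite cone_productE cone_beta_mu.
Qed.

Definition cone_theta m n : M := ract m (cone_beta n) - (cone_beta m : A) *: n.

Lemma cone_thetaDl n : {morph cone_theta^~ n : x y / x + y}.
Proof.
move=> x y; rewrite /cone_theta ractDl (raddfD (@cone_beta R A B)) scalerDl.
by rewrite opprD addrACA.
Qed.

Lemma cone_thetaDr m : {morph cone_theta m : x y / x + y}.
Proof.
move=> x y; rewrite /cone_theta (raddfD (@cone_beta R A B)) ractDr scalerDr.
by rewrite opprD addrACA.
Qed.

Lemma cone_theta_homog i j m n : homog M i m -> homog M j n ->
  cone_theta m n = (cone_diff alpha (cone_mu m n) + (cone_mu (cone_diff alpha m) n
    + cone_mu m (cone_diff alpha n) *~ sgn i) : M).
Proof.
move=> hm hn.
have [hb hx] := (cone_homogP _ _ _).1 hm.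
have [hd hy] := (cone_homogP _ _ _).1 hn.
rewrite /cone_theta (ract_homog hm hy).
rewrite -[X in X - _ = _]/(cone_smul alpha (cone_beta n) m *~ sgn (i * j)).
rewrite -[X in _ - X = _]/(cone_smul alpha (cone_beta m) n).
apply: cone_ext; last first.
  rewrite !raddfD raddfN !raddfMz /= cone_beta_diff !(cone_beta_mu, cone_beta_smul).
  by rewrite raddf0 !mul0rz !addr0 (gcA hx hy) subrr.
rewrite coneB1 !coneD1 !coneMz1 !cone_diff1 !cone_smul1 cone_beta_mu raddf0 sub0r.
rewrite !cone_mu1 !cone_diff1.
(* The exponents i j (right action), j ([gsign]) and j (i + 1) (commuting past b) add up to an even
   number. *)
have -> : alpha (gsign (cone_beta n)) * m.1 *~ sgn (i * j) = m.1 * alpha (cone_beta n).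
  have hay := dgh_deg alpha hy.
  rewrite (gsign_homog hy) raddfMz /= mulrzAl (gcB hay hb) -!mulrzA.
  by rewrite !sgn_simp; do 2!case: (odd _).
have em : gsign m.1 *~ sgn i = - m.1.
  rewrite (gsign_homog hb) -mulrzA -mulrN1z; congr (_ *~ _).
  by rewrite !sgn_simp; case: (odd _).
rewrite mulNrz -mulrzAl em mulNr opprK (raddfN (diff B)) opprK diffM gsignK.
rewrite (gsignB (alpha _)) gsign_diff opprK mulrDl mulrBr -alpha_gsign.
rewrite opprD addrACA [_ + (_ - _ * n.1)]addrC subrK.
by rewrite [_ + (_ - _)]addrC subrK addrC.
Qed.

(* Defining theta as d mu + mu d makes it a morphism for free; that it is     *)
(* balanced over A need not be checked separately.                            *)
Definition cone_theta_map : {additive T -> M} :=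
  (diff M \o cone_product) \+ (cone_product \o diff T).

Lemma cone_theta_mapE m n : cone_theta_map (tens m n) = cone_theta m n.
Proof.
move: m; apply: (@homog_ext _ M) => [x y|x y|||i m hm].
- by rewrite tensDl raddfD.
- exact: cone_thetaDl.
- by rewrite tens0l raddf0.
- by apply: (addrI (cone_theta 0 n)); rewrite -cone_thetaDl !addr0.
move: n; apply: (@homog_ext _ M) => [x y|x y|||j n hn].
- by rewrite tensDr raddfD.
- exact: cone_thetaDr.
- by rewrite tens0r raddf0.
- by apply: (addrI (cone_theta m 0)); rewrite -cone_thetaDr !addr0.
rewrite (cone_theta_homog hm hn) -[LHS]/(diff M (cone_product (tens m n)) +
  cone_product (tensor_diff M M (tens m n))).
by rewrite (tensor_diffE _ hm) raddfD raddfMz !cone_productE.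
Qed.

Lemma cone_theta_map_diff x :
  cone_theta_map (diff T x) = diff M (cone_theta_map x).
Proof.
rewrite -[LHS]/(diff M (cone_product (diff T x)) + cone_product (diff T (diff T x))).
rewrite -[RHS]/(diff M (diff M (cone_product x) + cone_product (diff T x))).
by rewrite (diffK T) raddfD diffK raddf0 addr0 add0r.
Qed.

(** mu has odd degree, so the two terms (d a) mu(x), from d mu and from mu d, carry opposite signs
    and cancel. *)
Lemma cone_theta_map_linear : Alinear 0 cone_theta_map.
Proof.
have [mu_deg mu_lin] := cone_product_linear.
split=> [i x hx|i a x ha].
  rewrite addr0; apply: homogD.
    by have := diff_deg (mu_deg _ _ hx); rewrite addrK.
  by have := mu_deg _ _ (diff_deg hx); rewrite subrK.
rewrite mulr0 mulr1z.
rewrite -[LHS]/(diff M (cone_product (a *: x)) + cone_product (diff T (a *: x))).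
rewrite -[RHS]/(a *: (diff M (cone_product x) + cone_product (diff T x))).
rewrite (mu_lin _ _ _ ha) raddfMz (dgm_leibniz _ ha).
rewrite (dgm_leibniz (M := T) _ ha) (raddfD cone_product) raddfMz.
rewrite (mu_lin _ _ _ ha) (mu_lin _ _ _ (diff_deg ha)).
rewrite scalerDr !mulr1 mulrzDl -!mulrzA.
have -> : sgn (i - 1) = - sgn i by rewrite !sgn_simp; case: (odd _).
have -> : sgn i * sgn i = 1 by rewrite !sgn_simp; case: (odd _).
by rewrite mulrNz !mulr1z addrACA subrr add0r.
Qed.

Definition cone_theta_hom : dgModHom T M :=
  DGModHom cone_theta_map_linear cone_theta_map_diff.

Lemma cone_mu_homog i m n : homog M i m ->
  cone_val (cone_mu m n) = (- (m.1 * n.1 *~ sgn (i + 1)), 0).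
Proof. by move=> hm; rewrite cone_mu_val (gsign_cone hm) mulrzAl. Qed.

(** Both B-coordinates are multiples of [m.1 * gsign n.1 * u.1]; [gsign] hits [m.1] twice on the
    left and once on the right, a discrepancy of (-1)^(i + 1). *)
Lemma cone_mu_assoc i m n u : homog M i m ->
  cone_mu (cone_mu m n) u = - (cone_mu m (cone_mu n u) *~ sgn i).
Proof.
move=> hm; apply: cone_ext; last first.
  by rewrite raddfN raddfMz /= !cone_beta_mu mul0rz oppr0.
rewrite coneN1 coneMz1 !cone_mu1 gsignN gsignM gsignK (gsign_cone hm).
rewrite mulrN !opprK !mulNr opprK mulrA -!mulrzAl -mulrzA.
have -> : sgn (i + 1) * sgn i = -1 by rewrite !sgn_simp; case: (odd _).
by rewrite mulrN1z !mulNr opprK.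
Qed.

(** Commuting the B-coordinates costs (i + 1)(j + 1) = i j + i + j + 1; the prefactors of mu absorb
    i + j and the 1 is the leading minus sign. *)
Lemma cone_mu_comm i j m n : homog M i m -> homog M j n ->
  cone_mu m n = - (cone_mu n m *~ sgn (i * j)).
Proof.
move=> hm hn; apply: cone_ext; last first.
  by rewrite raddfN raddfMz /= !cone_beta_mu mul0rz oppr0.
have [hb _] := (cone_homogP _ _ _).1 hm.
have [hd _] := (cone_homogP _ _ _).1 hn.
rewrite coneN1 coneMz1 !cone_mu1 (gsign_homog hb) (gsign_homog hd) !mulrzAl.
rewrite (gcB hd hb) mulNrz opprK -!mulrzA -mulrN1z -mulrzA; congr (_ *~ _).
by rewrite !sgn_simp; case: (odd (absz i)); case: (odd (absz j)).
Qed.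

Lemma cone_mu_diag i m : strictly_commutative B -> homog M i m ->
  ~~ odd (absz i) -> cone_mu m m = 0.
Proof.
move=> [_ sB] hm ei; apply: cone_ext; last by rewrite cone_beta_mu raddf0.
have [hb _] := (cone_homogP _ _ _).1 hm.
rewrite cone_mu1 (gsign_homog hb) mulrzAl (sB _ _ _ hb) ?mul0rz ?oppr0 //.
(* For |m| even, b has odd degree |m| + 1. *)
by rewrite oddzD addbT.
Qed.

End ConeProduct.

(** * Assembly, translating back to the coordinates (b, c) *)

Theorem theorem3p4 (R : comPzRingType) (A B : dgAlgebra R)
    (gcA : graded_commutative A) (gcB : graded_commutative B)
    (alpha : dgHom A B) :
  let C := cone_complex alpha in
  exists (act : scalar_action A (cone A B))
         (dgact : @is_dgmodule R A (lmod_of act) C),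
  let M := DGModule dgact in
  let T := tensor gcA M M in
  let t (m n : cone A B) : T := @tens R A M M m n in
  [/\ forall r (m : cone A B),
        smul act (dga_unit A r) m
          = (dga_unit B r * m.1, dga_unit A r * m.2) :> B * A,
      forall i j a (m : cone A B), homog A i a -> homog C j m -> 1 <= j ->
        smul act a m = ((alpha a * m.1) *~ sgn i, a * m.2) :> B * A,
      forall i a (m : cone A B), homog A i a -> homog C 0 m -> 1 <= i ->
        smul act a m
          = ((alpha a * m.1) *~ sgn i,
             - (a * dga_unit A (dga_base (diff B m.1)))) :> B * A &
  exists beta : dgModHom M (regular A),
  [/\ forall i (m : cone A B), homog C i m -> 1 <= i -> beta m = - m.2,
      forall m : cone A B, homog C 0 m ->
        beta m = dga_unit A (dga_base (diff B m.1)) &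
  exists theta : dgModHom T M,
    (forall m n : M, theta (t m n) = ract m (beta n) - (beta m : A) *: n) /\
  exists mu : {additive T -> M},
  [/\ Alinear 1 mu,
      forall x : T, diff M (mu x) + mu (diff T x) = theta x,
      [/\ forall i j (m n : cone A B),
            homog C i m -> homog C j n -> 1 <= i -> 1 <= j ->
            cone_val (mu (t m n)) = (- ((m.1 * n.1) *~ sgn (i + 1)), 0),
          forall j (m n : cone A B),
            homog C 0 m -> homog C j n -> 1 <= j ->
            cone_val (mu (t m n)) = (m.1 * n.1, 0),
          forall i (m n : cone A B),
            homog C i m -> homog C 0 n -> 1 <= i ->
            cone_val (mu (t m n)) = (- ((m.1 * n.1) *~ sgn (i + 1)), 0) &
          forall m n : cone A B, homog C 0 m -> homog C 0 n ->
            cone_val (mu (t m n)) = (m.1 * n.1, 0)],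
      forall x : T, beta (mu x) = 0 &
      [/\ forall i j k (m n u : M),
            homog M i m -> homog M j n -> homog M k u ->
            mu (t (mu (t m n)) u) = - (mu (t m (mu (t n u))) *~ sgn i),
          forall i j (m n : M), homog M i m -> homog M j n ->
            mu (t m n) = - (mu (t n m) *~ sgn (i * j)) &
          strictly_commutative B ->
          forall i (m : M), homog M i m -> ~~ odd (absz i) ->
            mu (t m m) = 0]]]].
Proof.
move=> C; exists (cone_action alpha), (cone_dgmodule alpha) => M T t.
split=> [r m|i j a m ha hm j1|i a m ha hm i1|].
- rewrite [LHS](cone_smul_val alpha m (homog_unit A r)) mulr1z dgh_unit.
  by rewrite /trunc homog_unit subrr mul0r subr0.
- rewrite [LHS](cone_smul_val alpha m ha) (dga_base_diff_cone hm j1).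
  by rewrite raddf0 mulr0 subr0.
- rewrite [LHS](cone_smul_val alpha m ha) (cone_homog0 hm) mulr0 sub0r.
  by rewrite /trunc (comp0_homog ha) ?subr0 //; lia.
exists (cone_beta_hom alpha); split=> [i m hm i1|m hm|].
- rewrite -[LHS]/(cone_beta m) /cone_beta (dga_base_diff_cone hm i1).
  by rewrite raddf0 sub0r.
- by rewrite -[LHS]/(cone_beta m) /cone_beta (cone_homog0 hm) subr0.
exists (cone_theta_hom gcA gcB alpha).
split; first exact: cone_theta_mapE.
(* The homotopy equation holds by the definition of theta. *)
exists (cone_product gcA gcB alpha); split=> //.
- exact: cone_product_linear.
- split=> [i j m n hm _ _ _|j m n hm _ _|i m n hm _ _|m n hm _];
    by rewrite /t cone_productE (cone_mu_homog _ hm) ?mulrN1z ?opprK.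
- exact: cone_beta_product.
split=> [i j k m n u hm _ _|i j m n hm hn|sB i m hm ei]; rewrite /t !cone_productE.
- exact: cone_mu_assoc hm.
- exact: (cone_mu_comm gcB hm hn).
exact: cone_mu_diag sB hm ei.
Qed.
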